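(* Let $\Omega$ be a finite non-empty possibility space, let $\mathcal{R}$ be a set of rewards, and let $\mathrm{opt}(\cdot\mid\cdot)$ be a conditional choice function on gambles $\Omega\to\mathcal{R}$. Then $\mathrm{opt}$ is subtree perfect if and only if both of the following hold: (a) for every event $A$, all gambles $X_1,\dots,X_n$ ($n\geq 1$) and $Z$, and every conditioning event $B$ with $A\cap B\neq\emptyset$ and $A^c\cap B\neq\emptyset$, $\mathrm{opt}$ is subtree perfect, conditional on $B$, for the decision tree whose root is a chance node with two arcs, where the arc labelled $A$ leads to a decision node with $n$ arcs leading to $X_1,\dots,X_n$ respectively, and the arc labelled $A^c$ leads to $Z$; (b) for all gambles $X_1,\dots,X_m$ ($m\geq 1$) and $Y_1,\dots,Y_n$ ($n\geq 1$), and every non-empty conditioning event $B$, $\mathrm{opt}$ is subtree perfect, conditional on $B$, for the decision tree whose root is a decision node with two arcs, one leading to a decision node with $m$ arcs leading to $X_1,\dots,X_m$ respectively, and the other leading to a decision node with $n$ arcs leading to $Y_1,\dots,Y_n$ respectively. (In (a) and (b), a gamble appearing in a tree stands for a terminal chance node representing that gamble, and only trees and conditioning events $B$ for which the tree has no path corresponding to the empty event, given $B$, are considered.)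
   Context: **Gambles and choice functions.** Events are subsets of the finite set $\Omega$; $\Omega$ is the certain event. A gamble is a map $X:\Omega\to\mathcal{R}$. A (conditional) choice function on gambles $\mathrm{opt}$ assigns to every non-empty finite set $\mathcal{X}$ of gambles and every non-empty event $E$ a non-empty subset $\mathrm{opt}(\mathcal{X}\mid E)\subseteq\mathcal{X}$. No other property is assumed; in particular $\mathrm{opt}$ does not depend on the tree or on decisions other than through $\mathcal{X}$ and $E$. **Decision trees.** A decision tree is a finite rooted tree with labelled (distinguishable) nodes. Each leaf carries a reward in $\mathcal{R}$. Each non-leaf node is either a decision node (the subject chooses which outgoing arc to follow; it has at least one outgoing arc) or a chance node (its outgoing arcs are labelled by events that form a partition of $\Omega$, and the arc whose event obtains is followed). A gamble $X$ appearing in a tree represents a terminal chance node: its arcs are labelled by events partitioning $\Omega$ and lead to rewards, such that the reward reached under $\omega$ is $X(\omega)$ (a constant gamble may be represented by a single reward leaf). **Conditioning events at nodes.** When a tree $T$ is considered conditional on a root conditioning event $B$, the conditioning event at a node $N$ of $T$ is the intersection of $B$ with all the events labelling chance arcs on the path from the root to $N$. Standing convention: only pairs of a tree $T$ and a conditioning event $B$ for which the conditioning event at every node is non-empty are considered. **Strategies.** A strategy of a tree $T$ is a subtree of $T$ obtained by selecting exactly one outgoing arc at each decision node, deleting all other decision arcs, and then deleting everything no longer connected to the root. Node labels are retained. Combinations of arc choices yielding the same subtree give the same strategy. Each strategy induces a gamble: the map sending $\omega\in\Omega$ to the reward reached by following the strategy when $\omega$ is the true state. **Normal form solution.** The solution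 of $T$ conditional on a non-empty event $E$ is the set of all strategies of $T$ whose induced gambles belong to $\mathrm{opt}(\mathcal{G}\mid E)$, where $\mathcal{G}$ is the set of gambles induced by all strategies of $T$. **Restriction.** For a node $N$ of $T$, the subtree of $T$ at $N$ consists of $N$ and all its descendants (with labels retained). The restriction of a set of strategies of $T$ to $N$ is obtained by discarding the strategies that do not contain $N$ and replacing every other strategy by its own subtree at $N$. **Subtree perfectness.** Let $T$ be a tree with root conditioning event $B$, and let $N$ be a node of $T$ with conditioning event $E$. The choice function is subtree perfect for $T$ at $N$, conditional on $B$, if either the restriction to $N$ of the solution of $T$ conditional on $B$ is empty, or this restriction equals the solution, conditional on $E$, of the subtree of $T$ at $N$. It is subtree perfect for $T$, conditional on $B$, if this holds at all nodes $N$ of $T$. The choice function is called subtree perfect (without further qualification) if it is subtree perfect for every decision tree $T$ conditional on the certain event $B=\Omega$. *)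

(* Defs.v *)
From Stdlib Require List.
From mathcomp Require Import all_boot.
From mathcomp Require Import classical_sets cardinality.

Set Implicit Arguments.
Unset Strict Implicit.
Unset Printing Implicit Defensive.

Local Open Scope classical_set_scope.

(* Events are finite sets [{set Omega}].  Sets of gambles and sets of
   strategies are classical [set]s, because rewards form an arbitrary type.
   Unqualified [set0] is the classical empty set; the constants for
   events are qualified by [finset]. *)

Definition gamble (Omega : finType) (R : Type) : Type := Omega -> R.

(* [opt X E] stands for opt(X | E).  As a function it is total, but it is
   constrained (and used) only for X finite and non-empty and E non-empty. *)
Definition choice_function (Omega : finType) (R : Type)
    (opt : set (gamble Omega R) -> {set Omega} -> set (gamble Omega R)) : Prop :=
  forall (X : set (gamble Omega R)) (E : {set Omega}),
    finite_set X -> X !=set0 -> E != finset.set0 ->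
    opt X E !=set0 /\ opt X E `<=` X.

(* The [nat] carried by a node is its label.  The type alone does not ask for
   distinct labels, partitions, or non-empty decision nodes; see
   [decision_tree]. *)
Inductive dtree (Omega : finType) (R : Type) : Type :=
| Reward of nat & R
| Decision of nat & seq (dtree Omega R)
| Chance of nat & seq ({set Omega} * dtree Omega R).

Arguments Reward {Omega R}.
Arguments Decision {Omega R}.
Arguments Chance {Omega R}.

Section DecisionTrees.
Variables (Omega : finType) (R : Type).
Local Notation event := {set Omega}.
Local Notation gamble := (gamble Omega R).
Local Notation dtree := (dtree Omega R).
Implicit Types (T N s t : dtree) (A B E H : event) (X Z : gamble).

Definition label T : nat :=
  match T with Reward l _ | Decision l _ | Chance l _ => l end.

Fixpoint labels T : seq nat :=
  match T with
  | Reward l _ => [:: l]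
  | Decision l ts => l :: flatten [seq labels t | t <- ts]
  | Chance l cs => l :: flatten [seq labels c.2 | c <- cs]
  end.

Fixpoint well_branched T : bool :=
  match T with
  | Reward _ _ => true
  | Decision _ ts => (0 < size ts) && all well_branched ts
  | Chance _ cs =>
      [&& uniq [seq c.1 | c <- cs],
          finset.partition [set E in [seq c.1 | c <- cs]]%SET finset.setT
        & all (fun c => well_branched c.2) cs]
  end.

Definition decision_tree T : bool := uniq (labels T) && well_branched T.

(* [node_of T H N]: the subtree of [T] at one of its nodes is [N], and [H] is
   the intersection of the events labelling the chance arcs on the path from
   the root of [T] to that node.  Hence, if [T] has root conditioning event
   [B], the conditioning event at the node is [B :&: H]. *)
Inductive node_of : dtree -> event -> dtree -> Prop :=
| node_root T : node_of T finset.setT T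
| node_decision l ts t H N :
    List.In t ts -> node_of t H N -> node_of (Decision l ts) H N
| node_chance l cs A t H N :
    List.In (A, t) cs -> node_of t H N -> node_of (Chance l cs) (A :&: H) N.

(* The standing convention on pairs of a tree and a conditioning event. *)
Definition consistent B T : Prop :=
  forall H N, node_of T H N -> B :&: H != finset.set0.

(* [strategy T s]: [s] is a strategy of [T].  A strategy is itself a tree, all
   of whose decision nodes have exactly one arc. *)
Inductive strategy : dtree -> dtree -> Prop :=
| strategy_reward l r : strategy (Reward l r) (Reward l r)
| strategy_decision l ts t s :
    List.In t ts -> strategy t s -> strategy (Decision l ts) (Decision l [:: s])
| strategy_chance l cs ds :
    strategy_arcs cs ds -> strategy (Chance l cs) (Chance l ds)
with strategy_arcs : seq (event * dtree) -> seq (event * dtree) -> Prop :=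
| strategy_arcs_nil : strategy_arcs [::] [::]
| strategy_arcs_cons A t s cs ds :
    strategy t s -> strategy_arcs cs ds ->
    strategy_arcs ((A, t) :: cs) ((A, s) :: ds).

Inductive reaches (w : Omega) : dtree -> R -> Prop :=
| reaches_reward l r : reaches w (Reward l r) r
| reaches_decision l s r : reaches w s r -> reaches w (Decision l [:: s]) r
| reaches_chance l cs A s r :
    List.In (A, s) cs -> w \in A -> reaches w s r -> reaches w (Chance l cs) r.

(* For a strategy [s] of a tree satisfying [decision_tree], exactly one gamble
   is induced by [s]. *)
Definition induces s X : Prop := forall w, reaches w s (X w).

Definition gambles_of T : set gamble :=
  [set X | exists2 s, strategy T s & induces s X].

Definition restriction (l : nat) (S : set dtree) : set dtree :=
  [set t | exists2 s, S s & (exists H, node_of s H t) /\ label t = l].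

(* Terminal chance nodes, and reward leaves for constant gambles. *)
Definition is_reward T : bool := if T is Reward _ _ then true else false.

Definition terminal T : bool :=
  match T with
  | Reward _ _ => true
  | Decision _ _ => false
  | Chance _ cs => all (fun c => is_reward c.2) cs
  end.

(* A gamble has many such representations (choice of partition and labels). *)
Definition represents X T : Prop := terminal T /\ induces T X.

Variable opt : set gamble -> event -> set gamble.

Definition solution T E : set dtree :=
  [set s | strategy T s /\ exists2 X, induces s X & opt (gambles_of T) E X].

(* [N] is the subtree at a node of [T] and [E] is its conditioning event. *)
Definition subtree_perfect_at T B N E : Prop :=
  restriction (label N) (solution T B) = set0 \/
  restriction (label N) (solution T B) = solution N E.

Definition subtree_perfect_for T B : Prop :=
  forall H N, node_of T H N -> subtree_perfect_at T B N (B :&: H).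

Definition subtree_perfect : Prop :=
  forall T, decision_tree T -> consistent finset.setT T ->
    subtree_perfect_for T finset.setT.

End DecisionTrees.

(* Main.v *)
Require Import Defs.
From Stdlib Require List.
From mathcomp Require Import all_boot.
From mathcomp Require Import boolp classical_sets cardinality.


(** Let [G_T] be the set of gambles of a tree [T].  A strategy of a tree is
    determined by its strategies at the children of the root, and restricting a
    set of strategies to a node can be done in two steps, through the child
    above that node ([restriction_restriction]).  So, by induction on trees,
    subtree perfectness for [T] only has to be checked at the children [t] of
    the root, where it becomes a statement about gambles alone
    ([decision_perfectP], [chance_perfectP]):

    - below a decision root, [opt G_T B] either misses [G_t] or meets it exactly
      in [opt G_t B];
    - below a chance root, on an arc labelled [A], the optimal members of [G_T]
      agree on [A] with exactly the members of [opt G_t (B :&: A)].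

    The two families of small trees express two properties of [opt] on finite
    sets of gambles.  The two-stage decision trees, taken with [S] and a superset
    [S'] of it as menus, give [submenu_coherent]: [opt S' B] misses [S] or meets
    it in [opt S B].  The two-arc chance trees give [mixture_coherent]: filling in
    a fixed gamble outside [A] commutes with choosing.  The first property is
    the condition at a decision root.  At a chance root, freeze an optimal gamble
    [W] off [A]: the slice of all gambles [mix A Y W] with [Y] in [G_t] is a
    subset of [G_T] that meets the optimal set, hence its optimal elements are
    those optimal in [G_T], and mixture coherence turns them into [opt G_t]
    ([chance_slice]).

    The convention that no conditioning event is empty restricts which gambles
    can appear: the gambles of a tree conditional on [E] take on [E] all the
    values that they take at all ([gambles_span]), and conversely each
    such gamble has a terminal tree consistent with [E] ([represent]).  This is
    why both properties carry hypotheses [spans], and why the frozen part [W] has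
    to be altered on [A] before mixture coherence applies to it.

    For the converse, a tree considered conditional on [B] is hung on an arc
    labelled [B] below a new chance root; every strategy of the larger tree
    passes through it, so its perfectness conditional on [B] is part of the
    perfectness of the larger tree conditional on the certain event
    ([perfect_conditional]). *)

Set Implicit Arguments.
Unset Strict Implicit.
Unset Printing Implicit Defensive.

Local Open Scope classical_set_scope.

(** * Lists over types without decidable equality *)

Lemma all_In (T : Type) (p : pred T) (s : seq T) :
  all p s <-> forall x, List.In x s -> p x.
Proof.
elim: s => [|y s IH] //=; split.
- by case/andP=> py /IH ps x [<-|/ps].
- by move=> ps; rewrite ps; [apply/IH => x xs; apply: ps; right | left].
Qed.

Lemma In_mem (T : Type) (U : eqType) (f : T -> U) (y : U) (s : seq T) :
  y \in [seq f x | x <- s] <-> exists2 x, List.In x s & y = f x.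
Proof.
elim: s => [|z s IH] /=; first by split=> // -[].
rewrite in_cons; split.
- by case/predU1P=> [->|/IH[x xs ->]]; [exists z=> //; left | exists x=> //; right].
- case=> x [<-|xs] e; apply/orP; [by left; apply/eqP | right].
  by apply/IH; exists x.
Qed.

Lemma uniq_map_In (T : Type) (U : eqType) (f : T -> U) (s : seq T) (x y : T) :
  uniq [seq f z | z <- s] -> List.In x s -> List.In y s -> f x = f y -> x = y.
Proof.
elim: s => [|z s IH] //= /andP[fz us] [<-|xs] [<-|ys] // e.
- by case/negP: fz; apply/In_mem; exists y.
- by case/negP: fz; apply/In_mem; exists x.
- exact: IH.
Qed.

Lemma In_flatten (T : Type) (U : eqType) (f : T -> seq U) (y : U) (s : seq T) :
  y \in flatten [seq f x | x <- s] <-> exists2 x, List.In x s & y \in f x.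
Proof.
elim: s => [|z s IH] /=; first by split=> // -[].
rewrite mem_cat; split.
- by case/orP=> [yz|/IH[x xs yx]]; [exists z=> //; left | exists x=> //; right].
- case=> x [<-|xs] yx; first by rewrite yx.
  by apply/orP; right; apply/IH; exists x.
Qed.

Lemma uniq_flatten_In (T : Type) (U : eqType) (f : T -> seq U) (s : seq T) x :
  uniq (flatten [seq f z | z <- s]) -> List.In x s -> uniq (f x).
Proof.
elim: s => [|z s IH] //=; rewrite cat_uniq => /and3P[uz _ us].
by case=> [<-|xs]; [|exact: IH].
Qed.

Lemma uniq_flatten_eq (T : Type) (U : eqType) (f : T -> seq U) (s : seq T)
    (x y : T) (l : U) :
  uniq (flatten [seq f z | z <- s]) -> List.In x s -> List.In y s ->
  l \in f x -> l \in f y -> x = y.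
Proof.
elim: s => [|z s IH] //=; rewrite cat_uniq => /and3P[_ /hasPn dz us].
have dis u : List.In u s -> l \in f u -> l \in f z -> False.
  move=> us' lu lz; suff /dz : l \in flatten [seq f v | v <- s] by rewrite /= lz.
  by apply/In_flatten; exists u.
move=> [<-|xs] [<-|ys] // lx ly; first by case: (dis y).
- by case: (dis x).
- exact: IH.
Qed.

Lemma subseq_flatten_In (T : Type) (U : eqType) (f : T -> seq U) (s : seq T) x :
  List.In x s -> subseq (f x) (flatten [seq f z | z <- s]).
Proof.
elim: s => [|z s IH] //= [<-|/IH sub]; first exact: prefix_subseq.
exact: subseq_trans sub (suffix_subseq _ _).
Qed.

Lemma Forall2_Inl (T U : Type) (P : T -> U -> Prop) s t x :
  List.Forall2 P s t -> List.In x s -> exists2 y, List.In y t & P x y.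
Proof.
elim=> [|a b s' t' Pab _ IH] //= [<-|/IH[y yt Pxy]].
- by exists b => //; left.
- by exists y => //; right.
Qed.

Lemma Forall2_Inr (T U : Type) (P : T -> U -> Prop) s t y :
  List.Forall2 P s t -> List.In y t -> exists2 x, List.In x s & P x y.
Proof.
elim=> [|a b s' t' Pab _ IH] //= [<-|/IH[x xt Pxy]].
- by exists a => //; left.
- by exists x => //; right.
Qed.

Definition elements (T : Type) (s : seq T) : set T := [set x | List.In x s].

Lemma finite_elements (T : Type) (S : set T) :
  finite_set S -> exists s : seq T, S = elements s.
Proof.
case/(@finite_seqP {classic T}) => s ->; exists s; apply/seteqP; split=> x.
- by rewrite /= -[s in x \in s]map_id => /In_mem[y ys ->].
- by move=> xs; rewrite /= -[s]map_id; apply/In_mem; exists x.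
Qed.

Section Trees.
Variables (Omega : finType) (R : Type).
Local Notation event := {set Omega}.
Local Notation gamble := (gamble Omega R).
Local Notation dtree := (dtree Omega R).
Implicit Types (T N s t u : dtree) (A B E H : event) (X Y Z W : gamble).

Lemma dtree_nested_ind (P : dtree -> Prop) :
  (forall l r, P (Reward l r)) ->
  (forall l ts, (forall t, List.In t ts -> P t) -> P (Decision l ts)) ->
  (forall l cs, (forall A t, List.In (A, t) cs -> P t) -> P (Chance l cs)) ->
  forall T, P T.
Proof.
move=> PR PD PC; fix IH 1; case=> [l r|l ts|l cs]; first exact: PR.
- apply: PD; elim: ts => [|t ts IHts] u; first by case.
  case=> [<-|ui]; [exact: (IH t) | exact: IHts ui].
- apply: PC; elim: cs => [|[A' t] cs IHcs] A u; first by case.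
  case=> [[_ <-]|ui]; [exact: (IH t) | exact: IHcs ui].
Qed.

(** * Children of the root *)

(** One relation for both kinds of inner node: a decision arc counts as labelled
    by the certain event, so that conditioning events are intersections of
    labels in either case. *)
Inductive child : dtree -> event -> dtree -> Prop :=
| child_decision l ts t : List.In t ts -> child (Decision l ts) finset.setT t
| child_chance l cs A t : List.In (A, t) cs -> child (Chance l cs) A t.

Lemma node_ofP T H N : node_of T H N <->
  (N = T /\ H = finset.setT) \/
  exists A t H', [/\ child T A t, node_of t H' N & H = A :&: H'].
Proof.
split.
- case=> [U|l ts t H' N' ti n|l cs A t H' N' ti n]; first by left.
  + by right; exists finset.setT, t, H'; rewrite finset.setTI; split=> //; exact: child_decision.
  + by right; exists A, t, H'; split=> //; exact: child_chance.
- case=> [[-> ->]|[A [t [H' [c n ->]]]]]; first exact: node_root.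
  case: c n => [l ts {}t ti|l cs {}A {}t ti] n.
  + by rewrite finset.setTI; apply: node_decision n.
  + exact: node_chance n.
Qed.

Lemma node_of_trans T H N H' M :
  node_of T H N -> node_of N H' M -> node_of T (H :&: H') M.
Proof.
elim=> {T H N} [T|l ts t H N ti n IH|l cs A t H N ti n IH] m.
- by rewrite finset.setTI.
- by apply: node_decision ti _; apply: IH.
- by rewrite -finset.setIA; apply: node_chance ti _; apply: IH.
Qed.

Lemma child_node T A t : child T A t -> node_of T A t.
Proof.
by move=> c; apply/node_ofP; right; exists A, t, finset.setT; split;
  [| exact: node_root | rewrite finset.setIT].
Qed.

Lemma label_in T : label T \in labels T.
Proof. by case: T => *; rewrite inE eqxx. Qed.

Lemma child_labels T A t : child T A t -> {subset labels t <= labels T}.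
Proof.
case=> [l ts {}t ti|l cs {}A {}t ti] m mt; rewrite inE; apply/orP; right.
- by apply/In_flatten; exists t.
- by apply/In_flatten; exists (A, t).
Qed.

Lemma node_label T H N : node_of T H N -> label N \in labels T.
Proof.
elim=> {T H N} [T|l ts t H N ti _ IH|l cs A t H N ti _ IH].
- exact: label_in.
- exact: child_labels (child_decision _ ti) _ IH.
- exact: child_labels (child_chance _ ti) _ IH.
Qed.

Lemma child_uniq T A t : uniq (labels T) -> child T A t ->
  uniq (labels t) /\ label T \notin labels t.
Proof.
move=> uT c; case: c uT => [l ts {}t ti|l cs {}A {}t ti] /= /andP[nl uf].
- split; first exact: uniq_flatten_In uf ti.
  by apply: contra nl => lt; apply/In_flatten; exists t.
- split; first exact: (uniq_flatten_In uf ti).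
  by apply: contra nl => lt; apply/In_flatten; exists (A, t).
Qed.

Lemma child_eq T A A' t t' m : uniq (labels T) -> child T A t -> child T A' t' ->
  m \in labels t -> m \in labels t' -> A = A' /\ t = t'.
Proof.
move=> uT c; case: c uT => [l ts {}t ti|l cs {}A {}t ti] /= /andP[_ uf] c';
  inversion_clear c' as [? ? ? ti'|? ? ? ? ti'] => mt mt'.
- by split=> //; exact: uniq_flatten_eq uf ti ti' mt mt'.
- have e : (A, t) = (A', t') by exact: (uniq_flatten_eq (l := m) uf ti ti').
  by case: e.
Qed.

(** [restriction] selects nodes by label; in a tree this pins down the root. *)
Lemma node_root_label T H N :
  uniq (labels T) -> node_of T H N -> label N = label T -> N = T.
Proof.
move=> uT /node_ofP[[]//|[A [t [H' [c /node_label n _]]]]] e.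
by case: (child_uniq uT c) => _ /negP[]; rewrite -e.
Qed.

Lemma consistentP B T : consistent B T <->
  B != finset.set0 /\ forall A t, child T A t -> consistent (B :&: A) t.
Proof.
split=> [cT|[B0 cc] H N /node_ofP[[_ ->]|[A [t [H' [c n ->]]]]]].
- split=> [|A t c H N n]; first by have := cT _ _ (node_root T); rewrite finset.setIT.
  rewrite -finset.setIA; apply: (cT _ N).
  by apply/node_ofP; right; exists A, t, H.
- by rewrite finset.setIT.
- by rewrite finset.setIA; exact: cc c _ _ n.
Qed.

Lemma decision_tree_child T A t : decision_tree T -> child T A t -> decision_tree t.
Proof.
case/andP=> uT wT c; rewrite /decision_tree (proj1 (child_uniq uT c)) /=.
case: c wT {uT} => [l ts {}t ti|l cs {}A {}t ti] /=.
- by case/andP=> _ /all_In; apply.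
- by case/and3P=> _ _ /all_In/(_ _ ti).
Qed.

(** * Strategies *)

Scheme strategy_mut := Minimality for strategy Sort Prop
  with strategy_arcs_mut := Minimality for strategy_arcs Sort Prop.

Lemma strategy_arcs_events (cs ds : seq (event * dtree)) : strategy_arcs cs ds ->
  [seq c.1 | c <- ds] = [seq c.1 | c <- cs].
Proof. by elim: cs ds => [|[A t] cs IH] ds a; inversion_clear a => //=; rewrite IH. Qed.

Lemma strategy_arcs_Inl (cs ds : seq (event * dtree)) A t : strategy_arcs cs ds ->
  List.In (A, t) cs -> exists2 s, List.In (A, s) ds & strategy t s.
Proof.
elim: cs ds => [|[A' t'] cs IH] ds a //=; inversion_clear a.
case=> [[<- <-]|ti]; first by exists s => //; left.
by case: (IH _ H0 ti) => v vi sv; exists v => //; right.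
Qed.

Lemma strategy_arcs_Inr (cs ds : seq (event * dtree)) A s : strategy_arcs cs ds ->
  List.In (A, s) ds -> exists2 t, List.In (A, t) cs & strategy t s.
Proof.
elim: cs ds => [|[A' t'] cs IH] ds a; inversion_clear a => //=.
case=> [[<- <-]|si]; first by exists t' => //; left.
by case: (IH _ H0 si) => v vi sv; exists v => //; right.
Qed.

Lemma strategy_child T s A u : strategy T s -> child s A u ->
  exists2 t, child T A t & strategy t u.
Proof.
case=> [l r|l ts t s' ti st|l cs ds a] c; inversion_clear c.
- by case: H => // <-; exists t => //; apply: child_decision.
- by case: (strategy_arcs_Inr a H) => t ti st; exists t => //; apply: child_chance.
Qed.

Lemma strategy_label T s : strategy T s -> label s = label T.
Proof. by case. Qed.

Lemma strategy_labels T s : strategy T s -> subseq (labels s) (labels T).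
Proof.
move: T s; apply: (@strategy_mut _ _ (fun T s => subseq (labels s) (labels T))
  (fun cs ds => subseq (flatten [seq labels d.2 | d <- ds])
                       (flatten [seq labels c.2 | c <- cs]))) => //=.
- by move=> *; rewrite eqxx.
- move=> l ts t s ti _ sub; rewrite eqxx cats0.
  exact: subseq_trans sub (subseq_flatten_In _ ti).
- by move=> *; rewrite eqxx.
- by move=> A t s cs ds _ s1 _ s2; apply: cat_subseq.
Qed.

Lemma strategy_uniq T s : strategy T s -> uniq (labels T) -> uniq (labels s).
Proof. by move=> /strategy_labels; apply: subseq_uniq. Qed.

Lemma strategy_mem T s : strategy T s -> {subset labels s <= labels T}.
Proof. by move=> /strategy_labels; apply: mem_subseq. Qed.

(** * Restriction passes through the children *)

(** Labels are distinct, so a strategy of [T] can contain a node labelled like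
    [t] only below the arc leading to [t], and only as its root. *)
Lemma restriction_child T A t (S : set dtree) : uniq (labels T) ->
  S `<=` strategy T -> child T A t ->
  restriction (label t) S =
  [set u | strategy t u /\ exists2 s, S s & child s A u].
Proof.
move=> uT ST c; have [ut nt] := child_uniq uT c.
apply/seteqP; split=> u /=.
- case=> s Ss [[H n] e]; have Ts := ST _ Ss.
  case/node_ofP: n => [[es _]|[A' [v [H' [cv nu _]]]]].
    by case/negP: nt; rewrite -(strategy_label Ts) -es e label_in.
  have [t' ct' st'] := strategy_child Ts cv.
  have lu : label t \in labels t'.
    by apply: (strategy_mem st'); rewrite -e; exact: node_label nu.
  have [eA et] := child_eq uT c ct' (label_in t) lu; subst A' t'.
  have -> : u = v.
    by apply: node_root_label nu _; rewrite ?(strategy_label st') //;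
       apply: strategy_uniq st' ut.
  by split=> //; exists s.
- case=> tu [s Ss cs]; exists s => //; split; last exact: strategy_label.
  by exists A; apply: child_node.
Qed.

(** A strategy that contains a node of [t] contains the root of [t], so discarding
    first the strategies that miss [t] loses nothing. *)
Lemma restriction_restriction T A t (S : set dtree) m : uniq (labels T) ->
  S `<=` strategy T -> child T A t -> m \in labels t ->
  restriction m (restriction (label t) S) = restriction m S.
Proof.
move=> uT ST c mt; have [ut nt] := child_uniq uT c.
rewrite (restriction_child uT ST c); apply/seteqP; split=> x [].
- move=> u [tu [s Ss cs]] [[H n] e]; exists s => //; split=> //.
  by exists (A :&: H); apply: node_of_trans n; apply: child_node.
- move=> s Ss [[H n] e]; have Ts := ST _ Ss.
  case/node_ofP: n => [[es _]|[A' [v [H' [cv nu _]]]]].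
    by case/negP: nt; rewrite -(strategy_label Ts) -es e.
  have [t' ct' st'] := strategy_child Ts cv.
  have lu : m \in labels t'.
    by apply: (strategy_mem st'); rewrite -e; exact: node_label nu.
  have [eA et] := child_eq uT c ct' mt lu; subst A' t'.
  by exists v; [split=> //; exists s | split=> //; exists H'].
Qed.

(** * Induced gambles *)

(** The condition on the arcs of a chance node in [well_branched], isolated
    because it passes from a tree to its strategies. *)
Definition splits (As : seq event) : bool :=
  uniq As && finset.partition [set E in As]%SET finset.setT.

Lemma splits_eq As A A' w : splits As -> A \in As -> A' \in As ->
  w \in A -> w \in A' -> A = A'.
Proof.
case/andP=> _ /and3P[_ tI _] Ai Ai' wA wA'.
have Bi : A \in [set E in As]%SET by rewrite inE.
have Bi' : A' \in [set E in As]%SET by rewrite inE.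
by rewrite -(finset.def_pblock tI Bi wA) (finset.def_pblock tI Bi' wA').
Qed.

Lemma splits_cover As w : splits As -> exists2 A, A \in As & w \in A.
Proof.
case/andP=> _ /and3P[/eqP cov _ _]; have: w \in finset.setT by rewrite inE.
by rewrite -cov => /bigcupP[A]; rewrite inE; exists A.
Qed.

Lemma arc_eq (cs : seq (event * dtree)) A A' t t' w :
  splits [seq c.1 | c <- cs] -> List.In (A, t) cs -> List.In (A', t') cs ->
  w \in A -> w \in A' -> A = A' /\ t = t'.
Proof.
move=> sp i i' wA wA'.
have e : A = A'.
  by apply: splits_eq sp _ _ wA wA'; apply/In_mem; [exists (A, t)|exists (A', t')].
split=> //; have /andP[u _] := sp.
by have [] := uniq_map_In u i i' e.
Qed.

Lemma arc_cover (cs : seq (event * dtree)) w :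
  splits [seq c.1 | c <- cs] -> exists A t, List.In (A, t) cs /\ w \in A.
Proof.
by case/(splits_cover w)=> A /In_mem[[A' t] i -> wA]; exists A', t.
Qed.

Lemma chance_splits l (cs : seq (event * dtree)) :
  well_branched (Chance l cs) -> splits [seq c.1 | c <- cs].
Proof. by rewrite /splits /= => /and3P[-> ->]. Qed.

Lemma child_branched T A t : well_branched T -> child T A t -> well_branched t.
Proof.
move=> wT c; case: c wT => [l ts {}t ti|l cs {}A {}t ti] /=.
- by case/andP=> _ /all_In; apply.
- by case/and3P=> _ _ /all_In/(_ _ ti).
Qed.

(** At each chance node exactly one arc contains the true state; hence existence,
    here, and uniqueness, next, of the reward reached. *)
Lemma strategy_reaches T s w : well_branched T -> strategy T s ->
  exists r, reaches w s r.
Proof.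
elim/dtree_nested_ind: T s => [l r|l ts IH|l cs IH] s wT sT.
- by inversion_clear sT; exists r; constructor.
- inversion_clear sT as [|? ? t s' ti st|].
  have [r re] := IH _ ti _ (child_branched wT (child_decision l ti)) st.
  by exists r; constructor.
- inversion_clear sT as [| |? ? ds a].
  have [A [t [ti wA]]] := arc_cover w (chance_splits wT).
  have [s' si st] := strategy_arcs_Inl a ti.
  have [r re] := IH _ _ ti _ (child_branched wT (child_chance l ti)) st.
  by exists r; apply: reaches_chance si wA re.
Qed.

Lemma strategy_reaches_eq T s w r r' : well_branched T -> strategy T s ->
  reaches w s r -> reaches w s r' -> r = r'.
Proof.
elim/dtree_nested_ind: T s => [l r0|l ts IH|l cs IH] s wT sT.
- by inversion_clear sT => h h'; inversion h; inversion h'; congruence.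
- inversion_clear sT as [|? ? t s' ti st|] => h h'.
  inversion_clear h; inversion_clear h'.
  exact: IH _ ti _ (child_branched wT (child_decision l ti)) st _ _.
- inversion_clear sT as [| |? ? ds a] => h h'.
  inversion_clear h as [| |? ? A u ? ui wA re].
  inversion_clear h' as [| |? ? A' u' ? ui' wA' re'].
  have sp : splits [seq c.1 | c <- ds].
    by rewrite (strategy_arcs_events a); apply: chance_splits wT.
  have [_ e] := arc_eq sp ui ui' wA wA'; subst u'.
  have [t ti st] := strategy_arcs_Inr a ui.
  exact: IH _ _ ti _ (child_branched wT (child_chance l ti)) st re re'.
Qed.

Lemma strategy_induces T s : well_branched T -> strategy T s ->
  exists X, induces s X.
Proof.
by move=> wT sT; apply: (fin_all_exists (P := fun w r => reaches w s r)) => w;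
  exact: strategy_reaches wT sT.
Qed.

Lemma strategy_induces_eq T s X Y : well_branched T -> strategy T s ->
  induces s X -> induces s Y -> X = Y.
Proof.
move=> wT sT sX sY; apply: funext => w.
exact: strategy_reaches_eq wT sT (sX w) (sY w).
Qed.

Lemma strategy_exists T : well_branched T -> exists s, strategy T s.
Proof.
elim/dtree_nested_ind: T => [l r|l ts IH|l cs IH] wT.
- by exists (Reward l r); constructor.
- case: ts IH wT => [//|t ts] IH wT.
  have ti : List.In t (t :: ts) by left.
  have [s st] := IH _ ti (child_branched wT (child_decision l ti)).
  by exists (Decision l [:: s]); apply: strategy_decision ti st.
- have {}IH A t : List.In (A, t) cs -> exists s, strategy t s.
    by move=> ti; apply: IH ti (child_branched wT (child_chance l ti)).
  suff [ds a] : exists ds, strategy_arcs cs ds.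
    by exists (Chance l ds); constructor.
  elim: cs IH {wT} => [|[A t] cs IHcs] IH; first by exists [::]; constructor.
  have [s st] := IH A t (or_introl erefl).
  have [|ds a] := IHcs; first by move=> A' t' i; apply: (IH A'); right.
  by exists ((A, s) :: ds); constructor.
Qed.

Lemma finite_strategies T : finite_set (strategy T).
Proof.
elim/dtree_nested_ind: T => [l r|l ts IH|l cs IH].
- apply: (sub_finite_set (B := [set Reward l r])) => // s sT.
  by inversion_clear sT.
- suff fin : finite_set [set s | exists2 t, List.In t ts & strategy t s].
    apply: sub_finite_set (finite_image (fun s => Decision l [:: s]) fin) => s sT.
    by inversion_clear sT as [|? ? t s' ti st|]; exists s' => //; exists t.
  elim: ts IH => [|t ts IHts] IH.
    by apply: (sub_finite_set (B := set0)) => // s [].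
  apply: (sub_finite_set (B := strategy t `|`
    [set s | exists2 t, List.In t ts & strategy t s])).
    by move=> s [u [<-|ui] su]; [left|right; exists u].
  rewrite finite_setU; split; first by apply: IH; left.
  by apply: IHts => u ui; apply: IH; right.
- suff fin : finite_set (strategy_arcs cs).
    apply: sub_finite_set (finite_image (Chance l) fin) => s sT.
    by inversion_clear sT as [| |? ? ds a]; exists ds.
  elim: cs IH => [|[A t] cs IHcs] IH.
    apply: (sub_finite_set (B := [set [::]])) => // ds a.
    by inversion_clear a.
  have f1 : finite_set (strategy t) by apply: (IH A); left.
  have f2 : finite_set (strategy_arcs cs).
    by apply: IHcs => A' u ui; apply: (IH A'); right.
  apply: sub_finite_set (finite_image2 (fun s ds => (A, s) :: ds) f1 f2) => ds a.
  by inversion_clear a as [|? ? s ? ds' st a']; exists s => //; exists ds'.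
Qed.

Lemma gambles_nonempty T : well_branched T -> gambles_of T !=set0.
Proof.
move=> wT; have [s sT] := strategy_exists wT.
by have [X sX] := strategy_induces wT sT; exists X, s.
Qed.

(** [opt] is constrained on finite sets only. *)
Lemma finite_gambles T : well_branched T -> finite_set (gambles_of T).
Proof.
move=> wT; have [X0 _] := gambles_nonempty wT.
have /choice[f fP] s : exists X, strategy T s -> induces s X.
  have [sT|nT] := pselect (strategy T s); last by exists X0.
  by have [X sX] := strategy_induces wT sT; exists X.
apply: sub_finite_set (finite_image f (finite_strategies T)) => X [s sT sX].
by exists s => //; apply: strategy_induces_eq wT sT (fP s sT) sX.
Qed.


Lemma dtree_child_ind (P : dtree -> Prop) :
  (forall T, (forall A t, child T A t -> P t) -> P T) -> forall T, P T.
Proof.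
move=> PT; elim/dtree_nested_ind=> [l r|l ts IH|l cs IH]; apply: PT => A t c;
  inversion_clear c; [exact: IH | exact: IH H].
Qed.

Lemma strategy_consistent B T s : consistent B T -> strategy T s -> consistent B s.
Proof.
elim/dtree_child_ind: s B T => s IH B T /consistentP[B0 cT] sT.
apply/consistentP; split=> // A u cu.
by have [t ct tu] := strategy_child sT cu; apply: IH cu _ t (cT _ _ ct) tu.
Qed.

Lemma reaches_consistent B s w r : consistent B s -> reaches w s r ->
  exists2 w', w' \in B & reaches w' s r.
Proof.
move=> cs re; elim: re B cs => {s r}
  [l r|l s r re IH|l cs A s r si wA re IH] B /consistentP[B0 cc].
- by have /set0Pn[w' w'B] := B0; exists w'; [|constructor].
- have c : child (Decision l [:: s]) finset.setT s by constructor; left.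
  have [w' w'B re'] := IH _ (cc _ _ c).
  by exists w'; [move: w'B; rewrite finset.setIT | constructor].
- have [w' /finset.setIP[w'B w'A] re'] := IH _ (cc _ _ (child_chance l si)).
  by exists w' => //; apply: reaches_chance si w'A re'.
Qed.

(** These are the gambles that a tree consistent with the conditioning event [E]
    can have. *)
Definition spans E X : Prop := forall w, exists2 w', w' \in E & X w' = X w.

(** Each leaf of a strategy has a non-empty conditioning event, and the reward at
    the leaf is obtained at every state in that event. *)
Lemma gambles_span B T X : well_branched T -> consistent B T ->
  gambles_of T X -> spans B X.
Proof.
move=> wT cT [s sT sX] w.
have [w' w'B re] := reaches_consistent (strategy_consistent cT sT) (sX w).
by exists w' => //; apply: strategy_reaches_eq wT sT (sX w') re.
Qed.

(** * Gambles and solutions at a decision root *)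

(** Solutions and their restrictions to children of the root both have this form,
    so comparing them amounts to comparing sets of gambles. *)
Definition implementing T (Q : set gamble) : set dtree :=
  [set s | strategy T s /\ exists2 X, induces s X & Q X].

(** Each strategy induces one gamble only, so [Q] can be read off on [gambles_of T]. *)
Lemma implementing_sub T (Q Q' : set gamble) : well_branched T ->
  implementing T Q `<=` implementing T Q' <->
  (forall X, gambles_of T X -> Q X -> Q' X).
Proof.
move=> wT; split=> [sub X [s sT sX] QX | sub s [sT [X sX QX]]].
- have [|_ [Y sY QY]] := sub s; first by split=> //; exists X.
  by rewrite (strategy_induces_eq wT sT sX sY).
- by split=> //; exists X => //; apply: sub => //; exists s.
Qed.

Lemma implementing_eq T (Q Q' : set gamble) : well_branched T ->
  implementing T Q = implementing T Q' <->
  (forall X, gambles_of T X -> (Q X <-> Q' X)).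
Proof.
move=> wT; rewrite seteqP !implementing_sub //; split=> [[s s'] X GX | e].
- by split; [exact: s | exact: s'].
- by split=> X GX; case: (e X GX).
Qed.

Lemma implementing_eq0 T (Q : set gamble) : well_branched T ->
  implementing T Q = set0 <-> (forall X, gambles_of T X -> ~ Q X).
Proof.
move=> wT; have e0 : implementing T set0 = set0.
  by apply/seteqP; split=> // s [_ []].
rewrite -{1}e0 implementing_eq //; split=> e X GX; have := e X GX.
- by move=> h QX; apply/h.
- by move=> h; split.
Qed.

Lemma induces_decision l s X : induces (Decision l [:: s]) X <-> induces s X.
Proof.
split=> sX w; first by have h := sX w; inversion_clear h.
by constructor.
Qed.

Lemma gambles_decision l ts X : gambles_of (Decision l ts) X <->
  exists2 t, List.In t ts & gambles_of t X.
Proof.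
split=> [[s sT]|[t ti [s st sX]]].
- inversion_clear sT as [|? ? t s' ti st|] => /induces_decision sX.
  by exists t => //; exists s'.
- exists (Decision l [:: s]); first exact: strategy_decision ti st.
  exact/induces_decision.
Qed.

Variable opt : set gamble -> event -> set gamble.

Lemma restriction_decision l ts t B : decision_tree (Decision l ts) ->
  List.In t ts ->
  restriction (label t) (solution opt (Decision l ts) B) =
  implementing t (opt (gambles_of (Decision l ts)) B).
Proof.
move=> /andP[uT _] ti.
rewrite (restriction_child uT _ (child_decision l ti)); last by move=> s [].
apply/seteqP; split=> u /= [tu].
- move=> [s [sT [X sX oX]] c]; split=> //; exists X => //.
  inversion sT as [|? ? t' s' _ _|]; subst s.
  inversion_clear c as [? ? ? i|]; case: i => // <-.
  by move/induces_decision: sX.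
- move=> [X uX oX]; split=> //.
  exists (Decision l [:: u]); last by constructor; left.
  split; first exact: strategy_decision ti tu.
  by exists X => //; apply/induces_decision.
Qed.

Lemma decision_perfectP l ts t B : decision_tree (Decision l ts) ->
  List.In t ts -> let T := Decision l ts in
  subtree_perfect_at opt T B t B <->
  (forall X, gambles_of t X -> ~ opt (gambles_of T) B X) \/
  (forall X, gambles_of t X ->
    (opt (gambles_of T) B X <-> opt (gambles_of t) B X)).
Proof.
move=> dT ti T; have /andP[_ wt] := decision_tree_child dT (child_decision l ti).
rewrite /subtree_perfect_at restriction_decision // implementing_eq0 //.
by rewrite implementing_eq.
Qed.

(** * Gambles and solutions at a chance root *)

(** The gamble written [A X + A^c Z]. *)
Definition mix A X Z : gamble := fun w => if w \in A then X w else Z w.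

Lemma mix_mix A X Y Z : mix A X (mix A Y Z) = mix A X Z.
Proof. by apply: funext => w; rewrite /mix; case: (w \in A). Qed.

Lemma induces_chance l (ds : seq (event * dtree)) W :
  splits [seq d.1 | d <- ds] ->
  induces (Chance l ds) W <->
  (forall A u w, List.In (A, u) ds -> w \in A -> reaches w u (W w)).
Proof.
move=> sp; split=> [sW A u w ui wA | h w].
- have re := sW w; inversion_clear re as [| |? ? A' u' ? ui' wA' re'].
  by have [_ ->] := arc_eq sp ui ui' wA wA'.
- have [A [u [ui wA]]] := arc_cover w sp.
  exact: reaches_chance ui wA (h _ _ _ ui wA).
Qed.

Lemma chance_arc_gamble l (cs : seq (event * dtree)) A t s W :
  well_branched (Chance l cs) -> List.In (A, t) cs ->
  strategy (Chance l cs) s -> induces s W ->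
  exists u X, [/\ strategy t u, child s A u, induces u X & W = mix A X W].
Proof.
move=> wT ti sT; inversion_clear sT as [| |? ? ds a] => sW.
have [u ui tu] := strategy_arcs_Inl a ti.
have wt := child_branched wT (child_chance l ti).
have [X uX] := strategy_induces wt tu.
exists u, X; split=> //; first exact: child_chance.
apply: funext => w; rewrite /mix; case: ifPn => // wA.
have sp : splits [seq d.1 | d <- ds].
  by rewrite (strategy_arcs_events a); apply: chance_splits wT.
apply: strategy_reaches_eq wt tu _ (uX w).
by move/(induces_chance _ _ sp): sW => sW; exact: sW ui wA.
Qed.

(** The choices on different arcs of a chance node are independent: the strategy on
    one arc can be exchanged while all others are kept. *)
Lemma strategy_arcs_swap (cs ds : seq (event * dtree)) A t u :
  strategy_arcs cs ds -> uniq [seq c.1 | c <- cs] -> List.In (A, t) cs ->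
  strategy t u ->
  exists ds', [/\ strategy_arcs cs ds', List.In (A, u) ds' &
    forall A' u', List.In (A', u') ds' ->
      A' = A /\ u' = u \/ A' <> A /\ List.In (A', u') ds].
Proof.
move=> a; elim: a t u => // {cs ds} A1 t1 s1 cs ds st1 a IH t u /= /andP[n1 us].
have other c : List.In c ds -> c.1 <> A1.
  move=> ci e; case/negP: n1; rewrite -(strategy_arcs_events a).
  by apply/In_mem; exists c.
move=> [[e1 e2]|ti] tu.
- subst A1 t1; exists ((A, u) :: ds); split; [by constructor | by left |].
  move=> A' u' [[-> ->]|i]; [by left | right; split; [exact: other i | by right]].
- have [ds' [a' ui h]] := IH t u us ti tu.
  exists ((A1, s1) :: ds'); split; [by constructor | by right |].
  move=> A' u' [[<- <-]|i]; last by have [|[? ?]] := h _ _ i; [left | right; split=> //; right].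
  right; split; last by left.
  by move=> e; case/negP: n1; apply/In_mem; exists (A, t).
Qed.

Lemma strategy_swap l (cs : seq (event * dtree)) A t s W u X :
  well_branched (Chance l cs) -> List.In (A, t) cs ->
  strategy (Chance l cs) s -> induces s W ->
  strategy t u -> induces u X ->
  exists s', [/\ strategy (Chance l cs) s', child s' A u & induces s' (mix A X W)].
Proof.
move=> wT ti sT; have sp := chance_splits wT.
inversion_clear sT as [| |? ? ds a] => sW tu uX.
have /andP[us _] := sp.
have [ds' [a' ui h]] := strategy_arcs_swap a us ti tu.
have ed := strategy_arcs_events a; have ed' := strategy_arcs_events a'.
exists (Chance l ds'); split; [by constructor | exact: child_chance |].
apply/induces_chance; first by rewrite ed'.
move=> A' u' w i wA'; rewrite /mix.
have [[eA eu]|[nA i']] := h _ _ i; first by subst A' u'; rewrite wA'.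
have -> : (w \in A) = false.
  apply/negP => wA; apply: nA; apply: (splits_eq sp _ _ wA' wA).
  - by rewrite -ed; apply/In_mem; exists (A', u').
  - by apply/In_mem; exists (A, t).
have /(induces_chance _ _ _) h' := sW; apply: (h' _ A' u') => //.
by rewrite ed.
Qed.

(** With [gambles_unmix] this makes the set of gambles at a chance root a product: it
    contains every combination of a gamble on [A] with a gamble off [A]. *)
Lemma gambles_mix l (cs : seq (event * dtree)) A t X W :
  well_branched (Chance l cs) -> List.In (A, t) cs ->
  gambles_of t X -> gambles_of (Chance l cs) W ->
  gambles_of (Chance l cs) (mix A X W).
Proof.
move=> wT ti [u tu uX] [s sT sW].
by have [s' [s'T _ s'M]] := strategy_swap wT ti sT sW tu uX; exists s'.
Qed.

Lemma gambles_unmix l (cs : seq (event * dtree)) A t W :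
  well_branched (Chance l cs) -> List.In (A, t) cs ->
  gambles_of (Chance l cs) W -> exists2 X, gambles_of t X & W = mix A X W.
Proof.
move=> wT ti [s sT sW].
have [u [X [tu _ uX eW]]] := chance_arc_gamble wT ti sT sW.
by exists X => //; exists u.
Qed.

Hypothesis opt_choice : choice_function opt.

Lemma opt_gambles T B : well_branched T -> B != finset.set0 ->
  opt (gambles_of T) B !=set0 /\ opt (gambles_of T) B `<=` gambles_of T.
Proof.
move=> wT B0.
exact: opt_choice (finite_gambles wT) (gambles_nonempty wT) B0.
Qed.

(** A strategy on the arc [A] occurs in an optimal strategy as soon as some optimal
    gamble agrees with its gamble on [A]: by [strategy_swap], it can be put
    into a strategy inducing that optimal gamble. *)
Lemma restriction_chance l (cs : seq (event * dtree)) A t B :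
  decision_tree (Chance l cs) -> B != finset.set0 -> List.In (A, t) cs ->
  restriction (label t) (solution opt (Chance l cs) B) =
  implementing t [set X | exists W, opt (gambles_of (Chance l cs)) B (mix A X W)].
Proof.
move=> /andP[uT wT] B0 ti.
have [_ oG] := opt_gambles wT B0.
have ct := child_chance l ti.
rewrite (restriction_child uT _ ct); last by move=> s [].
apply/seteqP; split=> u /= [tu].
- move=> [s [sT [W sW oW]] c]; split=> //.
  have [v [X [tv cv vX eW]]] := chance_arc_gamble wT ti sT sW.
  have [_ <-] : A = A /\ v = u.
    apply: child_eq (strategy_uniq sT uT) cv c (label_in v) _.
    by rewrite (strategy_label tv) -(strategy_label tu) label_in.
  by exists X => //; exists W; rewrite -eW.
- move=> [X uX [W oW]]; split=> //.
  have [s sT sW] := oG _ oW.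
  have [s' [s'T c s'M]] := strategy_swap wT ti sT sW tu uX.
  rewrite mix_mix in s'M.
  by exists s' => //; split=> //; exists (mix A X W).
Qed.

(** The restriction is never empty here, since every strategy of the whole tree
    contains the root of [t]. *)
Lemma chance_perfectP l (cs : seq (event * dtree)) A t B :
  decision_tree (Chance l cs) -> B != finset.set0 -> List.In (A, t) cs ->
  let T := Chance l cs in
  subtree_perfect_at opt T B t (B :&: A) <->
  (forall X, gambles_of t X ->
    ((exists W, opt (gambles_of T) B (mix A X W)) <->
     opt (gambles_of t) (B :&: A) X)).
Proof.
move=> dT B0 ti T; have /andP[_ wT] := dT.
have /andP[_ wt] := decision_tree_child dT (child_chance l ti).
rewrite /subtree_perfect_at (restriction_chance dT B0 ti) implementing_eq0 //.
rewrite implementing_eq //; split=> [[none|//]|h]; last by right.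
have [[W oW] oG] := opt_gambles wT B0.
have [X GX eW] := gambles_unmix wT ti (oG _ oW).
by case: (none X GX); exists W; rewrite -eW.
Qed.

(** * Trees whose gambles are prescribed *)

Lemma well_branched_pair l A t z :
  A != finset.set0 -> ~: A != finset.set0 ->
  well_branched t -> well_branched z ->
  well_branched (Chance l [:: (A, t); (~: A, z)]).
Proof.
move=> A0 cA0 wt wz.
have nA : A != ~: A.
  apply/eqP => e; have /set0Pn[w wA] := A0.
  by have := wA; rewrite {1}e inE wA.
have -> /= : well_branched (Chance l [:: (A, t); (~: A, z)]) =
    (uniq [:: A; ~: A] && finset.partition [set E in [:: A; ~: A]]%SET finset.setT).
  by rewrite /= wt wz !andbT.
rewrite inE nA /=.
have -> : [set E in [:: A; ~: A]]%SET = [set A; ~: A]%SET.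
  by apply/finset.setP => E; rewrite !inE.
rewrite /finset.partition /finset.cover /finset.trivIset !inE.
rewrite negb_or ![finset.set0 == _]eq_sym A0 cA0 /finset.cover.
rewrite !finset.big_setU1 ?inE //= !finset.big_set1 finset.setUCr.
by rewrite cardsC cardsT !eqxx.
Qed.

Lemma gambles_pair l A t z :
  well_branched (Chance l [:: (A, t); (~: A, z)]) ->
  gambles_of (Chance l [:: (A, t); (~: A, z)]) =
  [set mix A X Z | X in gambles_of t & Z in gambles_of z].
Proof.
move=> wT; apply/seteqP; split=> W.
- move=> GW; have i1 : List.In (A, t) [:: (A, t); (~: A, z)] by left.
  have i2 : List.In (~: A, z) [:: (A, t); (~: A, z)] by right; left.
  have [X GX e1] := gambles_unmix wT i1 GW.
  have [Z GZ e2] := gambles_unmix wT i2 GW.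
  exists X => //; exists Z => //.
  by rewrite [RHS]e1 e2; apply: funext => w; rewrite /mix inE; case: (w \in A).
- move=> [X [u tu uX] [Z [v zv vZ] <-]].
  exists (Chance l [:: (A, u); (~: A, v)]).
    by constructor; do ![constructor => //].
  move=> w; rewrite /mix; case: ifPn => wA.
  + by apply: (reaches_chance _ (A := A) (s := u)) => //; left.
  + apply: (reaches_chance _ (A := ~: A) (s := v)) => //; last by rewrite inE.
    by right; left.
Qed.

(** A terminal tree has no choice to make: its only strategy is itself. *)
Lemma gambles_terminal x X : well_branched x -> represents X x ->
  gambles_of x = [set X].
Proof.
move=> wx [tx xX].
have self s : strategy x s <-> s = x.
  case: x tx {wx xX} => [l r|//|l cs] /= tx.
    by split=> [st|->]; [inversion_clear st | constructor].
  have arcs ds : strategy_arcs cs ds <-> ds = cs.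
    elim: cs ds tx => [|[A t] cs IH] ds /=.
      by split=> [a|->]; [inversion_clear a | constructor].
    case: t => // l' r /= tx; split=> [a|->].
    - inversion_clear a as [|? ? s' ? ds' st a'].
      by inversion_clear st; have/IH -> := a'.
    - by constructor; [constructor | apply/IH].
  split=> [st|->]; last by constructor; apply/arcs.
  by inversion_clear st as [| |? ? ds a]; have/arcs -> := a.
have sx : strategy x x by apply/self.
apply/seteqP; split=> Y.
- move=> [s /self -> xY]; exact: strategy_induces_eq wx sx xY xX.
- by move=> ->; exists x.
Qed.

Lemma gambles_menu l Xs xs : (forall x, List.In x xs -> well_branched x) ->
  List.Forall2 (@represents Omega R) Xs xs ->
  gambles_of (Decision l xs) = elements Xs.
Proof.
move=> wxs rep; apply/seteqP; split=> X.
- move=> /gambles_decision[x xi]; have [Y Yi rY] := Forall2_Inr rep xi.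
  by rewrite (gambles_terminal (wxs _ xi) rY) => ->.
- move=> Xi; have [x xi rX] := Forall2_Inl rep Xi.
  apply/gambles_decision; exists x => //.
  by rewrite (gambles_terminal (wxs _ xi) rX).
Qed.

Hypothesis Omega_gt0 : 0 < #|Omega|.

Lemma spans_nonempty E X : spans E X -> E != finset.set0.
Proof.
have /card_gt0P[w _] := Omega_gt0.
by move=> /(_ w)[w' w'E _]; apply/set0Pn; exists w'.
Qed.

Lemma map_pickle_uniq (n : nat) (s : seq event) : uniq s ->
  uniq [seq n.+1 + pickle E | E <- s].
Proof. by rewrite map_inj_uniq // => E E' /addnI/(pcan_inj pickleK). Qed.

(** The partition of [Omega] into the level sets of [X] serves: each level set meets
    [E] because [X] takes all its values on [E].  The bound [n] lets several
    such trees be given disjoint sets of labels. *)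
Lemma represent E X n : spans E X ->
  exists x, [/\ represents X x, well_branched x, consistent E x, uniq (labels x) &
    forall m, m \in labels x -> n <= m].
Proof.
move=> sX; have /card_gt0P[w0 _] := Omega_gt0.
(* Rewards have no decidable equality; [{classic R}] supplies one. *)
pose P := @preim_partition Omega {classic R} X finset.setT.
have partP : finset.partition P finset.setT by exact: preim_partitionP.
(* The default [w0] is never met, blocks being non-empty. *)
pose value (K : event) := X (odflt w0 [pick w in K]).
have memP (K : event) w : K \in P -> w \in K ->
    forall w', w' \in K <-> X w' = X w.
  case/finset.imsetP => v _ -> wK w'; move: wK; rewrite !finset.in_set /=.
  by move/eqP=> <-; split=> [/eqP|e]; last exact/eqP.
have valE (K : event) w : K \in P -> w \in K -> value K = X w.
  move=> KP wK; rewrite /value; case: pickP => [v /(memP _ _ KP wK)//|/(_ w)].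
  by rewrite wK.
pose arc (K : event) := (K, Reward (n.+1 + pickle K) (value K) : dtree).
pose cs := [seq arc K | K <- enum P].
have events : [seq c.1 | c <- cs] = enum P by rewrite -map_comp map_id.
have csP A t : List.In (A, t) cs ->
    A \in P /\ t = Reward (n.+1 + pickle A) (value A).
  move=> i; have : (A, t).1 \in [seq c.1 | c <- cs].
    by apply/In_mem; exists (A, t).
  rewrite events mem_enum; split=> //.
   by move: i => /(List.in_map_iff _ _ _)[K [[<- <-] _]].
have inP (K : event) : K \in P -> List.In (arc K) cs.
  move=> KP; have : K \in [seq c.1 | c <- cs] by rewrite events mem_enum.
  case/In_mem=> [[A t] i /= ->]; have [_ et] := csP _ _ i.
  by rewrite /arc -et.
have labs : labels (Chance n cs) = n :: [seq n.+1 + pickle K | K <- enum P].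
  rewrite /= /cs; congr (_ :: _); elim: (enum P) => //= K s IH.
  by rewrite IH.
exists (Chance n cs); split.
- split.
    by apply/all_In => -[A t] /csP[_ ->].
  move=> w; have /bigcupP[K KP wK] : w \in finset.cover P.
    by have /and3P[/eqP -> _ _] := partP; rewrite inE.
  apply: (reaches_chance _ (inP _ KP) wK).
  by rewrite (valE _ _ KP wK); constructor.
- rewrite /= events enum_uniq /=; apply/andP; split; last first.
    by apply/all_In => -[A t] /csP[_ ->].
  suff -> : [set K in enum P]%SET = P by [].
  by apply/finset.setP => K; rewrite inE mem_enum.
- apply/consistentP; split=> [|A t c]; first exact: spans_nonempty sX.
  inversion_clear c as [|? ? ? ? ti]; have [AP ->] := csP _ _ ti.
  apply/consistentP; split=> [|A' t' c]; last by inversion c.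
  have /and3P[_ _ n0] := partP.
  have /set0Pn[w wA] : A != finset.set0 by apply: contra n0 => /eqP <-.
  have [w' w'E e] := sX w.
  by apply/set0Pn; exists w'; rewrite inE w'E; apply/(memP _ _ AP wA).
- rewrite labs /= map_pickle_uniq ?enum_uniq // andbT.
  apply/mapP => -[K _ e]; have: n < n by rewrite {2}e addSn ltnS leq_addr.
  by rewrite ltnn.
- move=> m; rewrite labs inE => /predU1P[->//|/mapP[K _ ->]].
  by rewrite addSn leqW // leq_addr.
Qed.

Lemma nat_bound (s : seq nat) : exists k, forall m, m \in s -> m < k.
Proof.
elim: s => [|a s [k IH]]; first by exists 0.
exists (maxn a.+1 k) => m; rewrite inE leq_max.
by case/predU1P=> [->|/IH ->]; rewrite ?leqnn ?orbT.
Qed.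

Lemma represent_all E Xs n : (forall X, List.In X Xs -> spans E X) ->
  exists xs, [/\ List.Forall2 (@represents Omega R) Xs xs,
    forall x, List.In x xs -> well_branched x /\ consistent E x,
    uniq (flatten [seq labels x | x <- xs]) &
    forall m, m \in flatten [seq labels x | x <- xs] -> n <= m].
Proof.
elim: Xs n => [|X Xs IH] n sXs; first by exists [::]; split.
have [|x [rx wx cx ux nx]] := @represent E X n; first by apply: sXs; left.
have [k kx] := nat_bound (labels x).
have [|xs [rxs wcxs uxs nxs]] := IH (maxn n k).
  by move=> Y Yi; apply: sXs; right.
exists (x :: xs); split.
- by constructor.
- by move=> y [<-|/wcxs].
- rewrite /= cat_uniq ux uxs andbT /=; apply/hasPn => m /nxs.
  rewrite geq_max => /andP[_ km]; apply/negP => /kx; rewrite ltnNge km; exact: notF.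
- move=> m /=; rewrite mem_cat => /orP[/nx //|/nxs].
  by rewrite geq_max => /andP[].
Qed.

Lemma menu_well_branched l Xs xs : Xs <> [::] ->
  List.Forall2 (@represents Omega R) Xs xs ->
  (forall x, List.In x xs -> well_branched x) -> well_branched (Decision l xs).
Proof.
move=> Xs0 rep wxs /=; apply/andP; split; last exact/all_In.
by case: rep Xs0.
Qed.

Lemma menu_consistent l (xs : seq dtree) E : E != finset.set0 ->
  (forall x, List.In x xs -> consistent E x) -> consistent E (Decision l xs).
Proof.
move=> E0 cxs; apply/consistentP; split=> // A x c.
by inversion_clear c as [? ? ? xi|]; rewrite finset.setIT; exact: cxs.
Qed.

Lemma elements_nonempty (T : Type) (s : seq T) :
  elements s !=set0 -> s <> [::] /\ 0 < size s.
Proof. by case: s => [[]|]. Qed.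

(** * Coherence of choice between menus *)

(** What perfectness for two-stage decision trees says about [opt] alone.  As
    [S] lies inside [S'], menus for [S] and [S'] offer together just [S'], so
    the union of two menus need not be mentioned. *)
Definition submenu_coherent : Prop :=
  forall B (S S' : set gamble), B != finset.set0 -> S !=set0 -> finite_set S' ->
  S `<=` S' -> (forall X, S' X -> spans B X) ->
  (forall X, S X -> ~ opt S' B X) \/ (forall X, S X -> (opt S' B X <-> opt S B X)).

(** What perfectness for two-arc chance trees says about [opt] alone. *)
Definition mixture_coherent : Prop :=
  forall A B (S : set gamble) Z, S !=set0 -> finite_set S ->
  B :&: A != finset.set0 -> B :&: ~: A != finset.set0 ->
  (forall X, S X -> spans (B :&: A) X) -> spans (B :&: ~: A) Z ->
  forall X, S X ->
  (opt [set mix A Y Z | Y in S] B (mix A X Z) <-> opt S (B :&: A) X).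

Lemma submenu_coherent_of_trees :
  (forall B (Xs Ys : seq gamble) (l l1 l2 : nat) (xs ys : seq dtree),
      0 < size Xs -> 0 < size Ys -> B != finset.set0 ->
      List.Forall2 (@represents Omega R) Xs xs ->
      List.Forall2 (@represents Omega R) Ys ys ->
      let T := Decision l [:: Decision l1 xs; Decision l2 ys] in
      decision_tree T -> consistent B T -> subtree_perfect_for opt T B) ->
  submenu_coherent.
Proof.
move=> perf B S S' B0 S0 fS' SS' sp.
have [Xs eS] := finite_elements (sub_finite_set SS' fS').
have [Ys eS'] := finite_elements fS'.
subst S S'.
have [nX sX] := elements_nonempty S0.
have [nY sY] : Ys <> [::] /\ 0 < size Ys.
  by apply: elements_nonempty; have [X SX] := S0; exists X; exact: SS'.
(* The inner nodes take the labels 0, 1 and 2. *)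
have [xs [rxs wcxs uxs nxs]] := @represent_all B Xs 3 (fun X i => sp _ (SS' _ i)).
have [k kx] := nat_bound (flatten [seq labels x | x <- xs]).
have [ys [rys wcys uys nys]] := @represent_all B Ys (maxn 3 k) sp.
have wxs x : List.In x xs -> well_branched x by case/wcxs.
have wys x : List.In x ys -> well_branched x by case/wcys.
pose t := Decision 1 xs; pose T := Decision 0 [:: t; Decision 2 ys].
have dT : decision_tree T.
  have wx := menu_well_branched 1 nX rxs wxs.
  have wy := menu_well_branched 2 nY rys wys.
  have wT : well_branched T by apply/all_In => x [<-|[<-|//]].
  rewrite /decision_tree wT andbT /= cats0 mem_cat !inE /= cat_uniq /= uxs uys !andbT.
  have freshx m : m < 3 -> m \notin flatten [seq labels x | x <- xs].
    by move=> m3; apply/negP => /nxs; rewrite leqNgt m3.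
  have freshy m : m < 3 -> m \notin flatten [seq labels x | x <- ys].
    move=> m3; apply/negP => /nys; rewrite geq_max => /andP[].
    by rewrite leqNgt m3.
  rewrite !negb_or !freshx //= !freshy //= mem_cat inE negb_or freshx //= freshy //= andbT.
  apply/hasPn => m /nys; rewrite geq_max => /andP[_ km].
  by apply/negP => /kx; rewrite ltnNge km.
have cT : consistent B T.
  by apply: menu_consistent => // x [<-|[<-|//]]; apply: menu_consistent => // y;
     [case/wcxs | case/wcys].
have ti : List.In t [:: t; Decision 2 ys] by left.
have := perf B Xs Ys 0 1 2 xs ys sX sY B0 rxs rys dT cT _ _
  (child_node (child_decision 0 ti)).
rewrite finset.setIT => /(decision_perfectP B dT ti).
have -> : gambles_of t = elements Xs by exact: gambles_menu.
suff -> : gambles_of (Decision 0 [:: t; Decision 2 ys]) = elements Ys by [].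
have eY : gambles_of (Decision 2 ys) = elements Ys by exact: gambles_menu.
apply/seteqP; split=> X.
- move/gambles_decision=> [u [<-|[<-|//]]]; last by rewrite eY.
  by rewrite (gambles_menu 1 wxs rxs) => /SS'.
- by move=> YX; apply/gambles_decision; exists (Decision 2 ys);
    [right; left | rewrite eY].
Qed.

Lemma mixture_coherent_of_trees :
  (forall A B (Xs : seq gamble) Z (l l1 : nat) (xs : seq dtree) (z : dtree),
      0 < size Xs -> A :&: B != finset.set0 -> ~: A :&: B != finset.set0 ->
      List.Forall2 (@represents Omega R) Xs xs -> represents Z z ->
      let T := Chance l [:: (A, Decision l1 xs); (~: A, z)] in
      decision_tree T -> consistent B T -> subtree_perfect_for opt T B) ->
  mixture_coherent.
Proof.
move=> perf A B S Z S0 fS AB AcB sp spZ.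
have [Xs eS] := finite_elements fS; subst S.
have [nX sX] := elements_nonempty S0.
have [xs [rxs wcxs uxs nxs]] := @represent_all (B :&: A) Xs 2 sp.
have [k kx] := nat_bound (flatten [seq labels x | x <- xs]).
have [z [rz wz cz uz nz]] := @represent (B :&: ~: A) Z (maxn 2 k) spZ.
have wxs x : List.In x xs -> well_branched x by case/wcxs.
pose t := Decision 1 xs; pose cs := [:: (A, t); (~: A, z)].
pose T := Chance 0 cs.
have [w /finset.setIP[wB wA]] := set0Pn _ AB.
have [w' /finset.setIP[w'B w'A]] := set0Pn _ AcB.
have B0 : B != finset.set0 by apply/set0Pn; exists w.
have wT : well_branched T.
  apply: well_branched_pair => //; [| | exact: menu_well_branched rxs wxs].
    by apply/set0Pn; exists w.
  by apply/set0Pn; exists w'.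
have dT : decision_tree T.
  rewrite /decision_tree wT andbT /= cats0 mem_cat !inE /= cat_uniq uxs uz !andbT.
  have freshx m : m < 2 -> m \notin flatten [seq labels x | x <- xs].
    by move=> m3; apply/negP => /nxs; rewrite leqNgt m3.
  have freshz m : m < 2 -> m \notin labels z.
    move=> m3; apply/negP => /nz; rewrite geq_max => /andP[].
    by rewrite leqNgt m3.
  rewrite !negb_or !mem_cat !negb_or !freshx //= !freshz //=.
  apply/hasPn => m /nz; rewrite geq_max => /andP[_ km].
  by apply/negP => /kx; rewrite ltnNge km.
have cT : consistent B T.
  apply/consistentP; split=> // A' t' c.
  inversion_clear c as [|? ? ? ? i]; case: i => [[<- <-]|[[<- <-]|//]] //.
  by apply: menu_consistent => // x /wcxs[].
have ti : List.In (A, t) cs by left.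
have := perf A B Xs Z 0 1 xs z sX _ _ rxs rz dT cT _ _
  (child_node (child_chance 0 ti)).
rewrite ![_ :&: B]finset.setIC => /(_ AB AcB) /(chance_perfectP dT B0 ti).
have -> : gambles_of t = elements Xs by exact: gambles_menu.
have eG : gambles_of (Chance 0 cs) = [set mix A Y Z | Y in elements Xs].
  rewrite gambles_pair // (gambles_menu 1 wxs rxs) (gambles_terminal wz rz).
  apply/seteqP; split=> W.
  - by move=> [X XX [_ -> <-]]; exists X.
  - by move=> [X XX <-]; exists X => //; exists Z.
rewrite eG => h X XX; rewrite -(h X XX); split=> [oW|[W oW]]; first by exists Z.
have [_ sub] := opt_gambles wT B0; move: (sub); rewrite eG => sub'.
have [Y _ e] := sub' _ oW.
suff -> : mix A X Z = mix A X W by [].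
apply: funext => v; have := congr1 (@^~ v) e; rewrite /mix.
by case: (v \in A).
Qed.

(** * Perfectness for all trees from coherence *)

Lemma decision_child_perfect l ts t B : submenu_coherent ->
  decision_tree (Decision l ts) -> consistent B (Decision l ts) ->
  List.In t ts -> subtree_perfect_at opt (Decision l ts) B t B.
Proof.
move=> sub dT cT ti; have /andP[_ wT] := dT; have [B0 _] := (consistentP _ _).1 cT.
have wt := child_branched wT (child_decision l ti).
apply/decision_perfectP => //; apply: sub => //.
- exact: gambles_nonempty.
- exact: finite_gambles.
- by move=> X GX; apply/gambles_decision; exists t.
- by move=> X; apply: gambles_span.
Qed.

(** The sharpening of [gambles_span] to the complement of one arc: the states off
    [A] lie on other arcs, whose subtrees are consistent with their own
    conditioning events. *)
Lemma gambles_span_off l (cs : seq (event * dtree)) A t B W :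
  well_branched (Chance l cs) -> consistent B (Chance l cs) ->
  List.In (A, t) cs -> gambles_of (Chance l cs) W ->
  forall w, w \notin A -> exists2 w', w' \in B :&: ~: A & W w' = W w.
Proof.
move=> wT cT ti GW w wA; have sp := chance_splits wT.
have [A' [t' [ti' wA']]] := arc_cover w sp.
have [X GX eX] := gambles_unmix wT ti' GW.
have c' := child_chance l ti'.
have [_ /(_ _ _ c') ct'] := (consistentP _ _).1 cT.
have [w' /finset.setIP[w'B w'A'] e] :=
  gambles_span (child_branched wT c') ct' GX w.
exists w'; last by rewrite eX /mix w'A' wA' e.
rewrite finset.in_setI w'B finset.in_setC; apply: contra wA => w'A.
by have [-> _] := arc_eq sp ti ti' w'A w'A'.
Qed.

(** Fixing a gamble [W] off [A], submenu coherence compares the slice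
    [{mix A Y W}] with all gambles of the tree, and mixture coherence compares the
    slice with the gambles on the arc. *)
Lemma chance_slice l (cs : seq (event * dtree)) A t B W :
  submenu_coherent -> mixture_coherent ->
  well_branched (Chance l cs) -> consistent B (Chance l cs) ->
  List.In (A, t) cs -> A != finset.setT ->
  let T := Chance l cs in
  gambles_of T W ->
  (forall Y, gambles_of t Y -> ~ opt (gambles_of T) B (mix A Y W)) \/
  (forall Y, gambles_of t Y ->
    (opt (gambles_of T) B (mix A Y W) <-> opt (gambles_of t) (B :&: A) Y)).
Proof.
move=> sub mixc wT cT ti nA T GW.
have [B0 cc] := (consistentP _ _).1 cT; have ct := cc _ _ (child_chance l ti).
have [BA0 _] := (consistentP _ _).1 ct.
have wt := child_branched wT (child_chance l ti).
have off := gambles_span_off wT cT ti GW.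
have /set0Pn[w1] : ~: A != finset.set0.
  by rewrite -finset.setCT (inj_eq (@finset.setC_inj _)).
rewrite finset.in_setC => /off[w0 w0E _].
have BcA0 : B :&: ~: A != finset.set0 by apply/set0Pn; exists w0.
(* A terminal tree at an event E can carry only a gamble all of whose values
   occur on E; so W is made constant on A, with a value it takes on the
   event conditioning the other arc. *)
pose Z : gamble := fun w => if w \in A then W w0 else W w.
have mZ Y : mix A Y W = mix A Y Z.
  by apply: funext => w; rewrite /mix /Z; case: (w \in A).
have offA w : w \in B :&: ~: A -> (w \in A) = false.
  by rewrite finset.in_setI finset.in_setC => /andP[_ /negbTE].
have spZ : spans (B :&: ~: A) Z.
  move=> w; rewrite /Z; case: ifPn => wA; first by exists w0 => //; rewrite offA.
  by have [w' w'E e] := off _ wA; exists w' => //; rewrite offA.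
have mixE := mixc A B (gambles_of t) Z (gambles_nonempty wt)
  (finite_gambles wt) BA0 BcA0 (fun Y => gambles_span wt ct (X := Y)) spZ.
have [Y0 GY0] := gambles_nonempty wt.
have [|||Y GY|none|all] :=
  sub B [set mix A Y Z | Y in gambles_of t] (gambles_of T) B0.
- by exists (mix A Y0 Z), Y0.
- exact: finite_gambles.
- by move=> _ [Y GY <-]; rewrite -mZ; exact: gambles_mix wT ti GY GW.
- exact: gambles_span GY.
- by left=> Y GY; rewrite mZ; apply: none; exists Y.
- by right=> Y GY; rewrite mZ -mixE //; apply: all; exists Y.
Qed.

Lemma chance_child_perfect l (cs : seq (event * dtree)) A t B :
  submenu_coherent -> mixture_coherent ->
  decision_tree (Chance l cs) -> consistent B (Chance l cs) ->
  List.In (A, t) cs -> subtree_perfect_at opt (Chance l cs) B t (B :&: A).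
Proof.
move=> sub mixc dT cT ti; have /andP[_ wT] := dT.
have [B0 _] := (consistentP _ _).1 cT.
have [[W0 oW0] oG] := opt_gambles wT B0.
apply/chance_perfectP => // X GX.
have [eA|nA] := eqVneq A finset.setT.
- (* A chance node with the certain event on an arc has the same gambles as
     the subtree there. *)
  have mixT Y W : mix A Y W = Y.
    by apply: funext => w; rewrite /mix eA finset.in_setT.
  have eG : gambles_of (Chance l cs) = gambles_of t.
    apply/seteqP; split=> Y GY.
    - by have [Y' GY' ->] := gambles_unmix wT ti GY; rewrite mixT.
    - by rewrite -(mixT Y W0); exact: gambles_mix wT ti GY (oG _ oW0).
  rewrite eA finset.setIT -eG; split=> [[W]|oX]; first by rewrite -eA mixT.
  by exists W0; rewrite -eA mixT.
- have slice := chance_slice sub mixc wT cT ti nA.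
  split=> [[W oW]|oX].
  + have := slice _ (oG _ oW); rewrite /= => -[none|all].
      by case: (none X GX); rewrite mix_mix.
    by apply/all => //; rewrite mix_mix.
  + have [Y GY eW0] := gambles_unmix wT ti (oG _ oW0).
    have [none|all] := slice _ (oG _ oW0); last by exists W0; apply/all.
    by case: (none Y GY); rewrite -eW0.
Qed.

Lemma perfect_of_coherent : submenu_coherent -> mixture_coherent ->
  forall T B, decision_tree T -> consistent B T -> subtree_perfect_for opt T B.
Proof.
move=> sub mixc; elim/dtree_child_ind=> T IH B dT cT H N.
have /andP[uT wT] := dT.
have sT : solution opt T B `<=` @strategy Omega R T by move=> s [].
case/node_ofP=> [[-> ->]|[A [t [H' [c n ->]]]]].
  right; rewrite finset.setIT; apply/seteqP; split=> s.
  - move=> [s' ss' [[H' n'] e]]; have Ts' := sT _ ss'.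
    have -> // : s = s'.
    by apply: node_root_label (strategy_uniq Ts' uT) n' _; rewrite e (strategy_label Ts').
  - move=> ss; exists s => //; split; last by apply: strategy_label; exact: sT.
    by exists finset.setT; exact: node_root.
have perf_t : subtree_perfect_at opt T B t (B :&: A).
  case: c dT cT {IH uT wT sT n} => [l ts {}t ti|l cs {}A {}t ti] dT cT.
  - by rewrite finset.setIT; apply: decision_child_perfect.
  - exact: chance_child_perfect.
rewrite /subtree_perfect_at.
rewrite -(restriction_restriction uT sT c (node_label n)) finset.setIA.
have [_ /(_ _ _ c) ct] := (consistentP _ _).1 cT.
case: perf_t => ->; first by left; apply/seteqP; split=> // x [].
exact: IH c _ (decision_tree_child dT c) ct _ _ n.
Qed.

(** * Conditioning by embedding *)

(** The chance root whose arcs are [B], leading to [T], and its complement, leading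
    to an arbitrary reward, makes [B] the conditioning event at [T]. *)
Lemma perfect_conditional : subtree_perfect opt ->
  forall T B, decision_tree T -> consistent B T -> subtree_perfect_for opt T B.
Proof.
move=> perf T B dT cT.
have [eB|nB] := eqVneq B finset.setT; first by subst B; exact: perf.
have /andP[uT wT] := dT; have [B0 _] := (consistentP _ _).1 cT.
have cB0 : ~: B != finset.set0 by rewrite -finset.setCT (inj_eq (@finset.setC_inj _)).
have /card_gt0P[w _] := Omega_gt0; have [X _] := gambles_nonempty wT.
have [k kT] := nat_bound (labels T).
pose cs := [:: (B, T); (~: B, Reward k (X w))]; pose T' := Chance k.+1 cs.
have ti : List.In (B, T) cs by left.
have c := child_chance k.+1 ti.
have wT' : well_branched T' by exact: well_branched_pair.
have nk m : k <= m -> m \notin labels T.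
  by move=> km; apply/negP => /kT; rewrite ltnNge km.
have dT' : decision_tree T'.
  rewrite /decision_tree wT' andbT /= mem_cat inE negb_or nk //= cat_uniq uT /=.
  by rewrite orbF nk // gtn_eqF.
have cT' : consistent finset.setT T'.
  apply/consistentP; split.
    by apply/set0Pn; exists w; rewrite finset.in_setT.
  move=> A t c'; inversion_clear c' as [|? ? ? ? i].
  case: i => [[<- <-]|[[<- <-]|//]]; rewrite finset.setTI //.
  by apply/consistentP; split=> // A' t' c'; inversion c'.
have sT' : solution opt T' finset.setT `<=` @strategy Omega R T' by move=> s [].
have /andP[uT' _] := dT'.
have [T0 _] := (consistentP _ _).1 cT'.
have eT : restriction (label T) (solution opt T' finset.setT) = solution opt T B.
  have := perf T' dT' cT' _ _ (child_node c).
  rewrite finset.setTI => -[|//].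
  rewrite (restriction_chance dT' T0 ti) (implementing_eq0 _ wT) => none.
  have [[W oW] oG] := opt_gambles wT' T0.
  have [Y GY eW] := gambles_unmix wT' ti (oG _ oW).
  by case: (none Y GY); exists W; rewrite -eW.
move=> H N n; rewrite /subtree_perfect_at -eT.
rewrite (restriction_restriction uT' sT' c (node_label n)).
have n' : node_of T' (B :&: H) N by exact: node_of_trans (child_node c) n.
by have := perf T' dT' cT' _ _ n'; rewrite finset.setTI.
Qed.

End Trees.

Theorem theorem2 (Omega : finType) (R : Type)
    (opt : set (gamble Omega R) -> {set Omega} -> set (gamble Omega R)) :
  0 < #|Omega| ->
  choice_function opt ->
  (subtree_perfect opt <->
   (* (a) *)
   (forall (A B : {set Omega}) (Xs : seq (gamble Omega R)) (Z : gamble Omega R)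
      (l l1 : nat) (xs : seq (dtree Omega R)) (z : dtree Omega R),
      0 < size Xs ->
      A :&: B != finset.set0 -> ~: A :&: B != finset.set0 ->
      List.Forall2 (@represents Omega R) Xs xs -> represents Z z ->
      let T := Chance l [:: (A, Decision l1 xs); (~: A, z)] in
      decision_tree T -> consistent B T -> subtree_perfect_for opt T B)
   /\
   (* (b) *)
   (forall (B : {set Omega}) (Xs Ys : seq (gamble Omega R))
      (l l1 l2 : nat) (xs ys : seq (dtree Omega R)),
      0 < size Xs -> 0 < size Ys ->
      B != finset.set0 ->
      List.Forall2 (@represents Omega R) Xs xs ->
      List.Forall2 (@represents Omega R) Ys ys ->
      let T := Decision l [:: Decision l1 xs; Decision l2 ys] in
      decision_tree T -> consistent B T -> subtree_perfect_for opt T B)).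
Proof.
move=> Omega_gt0 opt_choice; split=> [perf|[chance decision] T dT cT].
  by split=> *; apply: perfect_conditional.
apply: perfect_of_coherent => //.
- exact: submenu_coherent_of_trees.
- exact: mixture_coherent_of_trees.
Qed.
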